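(* Let $n\ge 1$, $1\le r\le n$, and let $F:\mathbb{R}^{n\times n}\to\mathbb{R}$ be twice continuously differentiable, $\mu_F$-strongly convex and $L_F$-smooth. Let $f:\mathbb{R}^{n\times r}\to\mathbb{R}$ be defined by $f(X)=F(XX^T)$. For $\alpha,\beta\ge 0$ and $\sigma>0$ let $$h_G(X)=\frac{\alpha}{4}\|X\|^4+\frac{\beta}{4}\|X^TX\|^2+\frac{\sigma}{2}\|X\|^2,\qquad X\in\mathbb{R}^{n\times r}.$$ If $\alpha\ge 2(L_F-\mu_F)$, $\beta\ge 2L_F$ and $\sigma\ge 2\|\nabla F(0)\|$, then $f$ is $1$-smooth relative to $h_G$.
   Context: $\|\cdot\|$ is the Frobenius norm and $\langle X,Y\rangle=\mathrm{Tr}(X^TY)$ the associated inner product on matrices; gradients are taken with respect to this inner product. $F$ is $\mu_F$-strongly convex and $L_F$-smooth, with constants $0\le\mu_F\le L_F$, means that for all $X,Y\in\mathbb{R}^{n\times n}$, $$\langle\nabla F(X)-\nabla F(Y),X-Y\rangle\ge\mu_F\|X-Y\|^2,\qquad \|\nabla F(X)-\nabla F(Y)\|\le L_F\|X-Y\|.$$ For a differentiable strictly convex function $h:\mathbb{R}^{n\times r}\to\mathbb{R}$ (a distance kernel), the Bregman distance is $D_h(X,Y)=h(X)-h(Y)-\langle\nabla h(Y),X-Y\rangle$. A differentiable $f:\mathbb{R}^{n\times r}\to\mathbb{R}$ is $L$-smooth relative to $h$ (with $L>0$) if for all $X,Y\in\mathbb{R}^{n\times r}$, $$f(X)\le f(Y)+\langle\nabla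 f(Y),X-Y\rangle+L\,D_h(X,Y).$$ *)

(* Defs.v *)
From HB Require Import structures.
From mathcomp Require Import all_boot all_order all_algebra.
From mathcomp Require Import all_classical all_reals all_analysis.

Set Implicit Arguments.
Unset Strict Implicit.
Unset Printing Implicit Defensive.
Import Order.TTheory GRing.Theory Num.Theory.
Import numFieldNormedType.Exports.

Local Open Scope classical_set_scope.
Local Open Scope ring_scope.

Definition frob_dot (R : realType) (m p : nat) (X Y : 'M[R]_(m, p)) : R :=
  \tr (X^T *m Y).

(* The library norm `|X| on matrices is the entrywise maximum, not this one;
   both induce the same topology and the same notion of differentiability. *)
Definition frob_norm (R : realType) (m p : nat) (X : 'M[R]_(m, p)) : R :=
  Num.sqrt (frob_dot X X).

Definition grad (R : realType) (m p : nat) (f : 'M[R]_(m, p) -> R)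
    (X : 'M[R]_(m, p)) : 'M[R]_(m, p) :=
  \matrix_(i, j) 'd f X (delta_mx i j).

(* grad f X is the Riesz representative of the differential for frob_dot. *)
Lemma frob_dot_grad (R : realType) (m p : nat) (f : 'M[R]_(m, p) -> R)
    (X H : 'M[R]_(m, p)) : frob_dot (grad f X) H = 'd f X H.
Proof.
rewrite {2}[H]matrix_sum_delta linear_sum /frob_dot /mxtrace.
under eq_bigr do rewrite mxE.
rewrite exchange_big; apply: eq_bigr => i _; rewrite linear_sum.
by apply: eq_bigr => j _; rewrite linearZ !mxE mulrC.
Qed.

(* Continuity of x |-> 'd g x is with respect to the operator norm. *)
Definition continuously_differentiable (R : realType) (V W : normedModType R)
    (g : V -> W) : Prop :=
  (forall x, differentiable g x) /\
  (forall (x : V) (e : R), 0 < e ->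
     \forall y \near x, forall v : V, `|'d g y v - 'd g x v| <= e * `|v|).

Definition twice_continuously_differentiable (R : realType) (m p : nat)
    (f : 'M[R]_(m, p) -> R) : Prop :=
  (forall X, differentiable f X) /\ continuously_differentiable (grad f).

Definition strongly_convex (R : realType) (m p : nat) (mu : R)
    (f : 'M[R]_(m, p) -> R) : Prop :=
  forall X Y, mu * frob_norm (X - Y) ^+ 2
              <= frob_dot (grad f X - grad f Y) (X - Y).

Definition smooth (R : realType) (m p : nat) (L : R)
    (f : 'M[R]_(m, p) -> R) : Prop :=
  forall X Y, frob_norm (grad f X - grad f Y) <= L * frob_norm (X - Y).

Definition strictly_convex (R : realType) (m p : nat)
    (h : 'M[R]_(m, p) -> R) : Prop :=
  forall (X Y : 'M[R]_(m, p)) (t : R), X <> Y -> 0 < t < 1 ->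
    h (t *: X + (1 - t) *: Y) < t * h X + (1 - t) * h Y.

Definition distance_kernel (R : realType) (m p : nat)
    (h : 'M[R]_(m, p) -> R) : Prop :=
  (forall X, differentiable h X) /\ strictly_convex h.

Definition bregman (R : realType) (m p : nat) (h : 'M[R]_(m, p) -> R)
    (X Y : 'M[R]_(m, p)) : R :=
  h X - h Y - frob_dot (grad h Y) (X - Y).

(* The requirements under which the notion is defined (h is a distance kernel,
   f is differentiable, L > 0) are part of the predicate. *)
Definition relatively_smooth (R : realType) (m p : nat) (L : R)
    (h f : 'M[R]_(m, p) -> R) : Prop :=
  [/\ distance_kernel h,
      forall X, differentiable f X,
      0 < L
    & forall X Y, f X <= f Y + frob_dot (grad f Y) (X - Y) + L * bregman h X Y].

Definition gram_kernel (R : realType) (n r : nat) (alpha beta sigma : R)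
    (X : 'M[R]_(n, r)) : R :=
  alpha / 4 * frob_norm X ^+ 4 + beta / 4 * frob_norm (X^T *m X) ^+ 2
  + sigma / 2 * frob_norm X ^+ 2.

(* Main.v *)
Require Import Defs.
From mathcomp Require Import all_boot all_order all_algebra.
From mathcomp Require Import all_classical all_reals all_analysis.
From mathcomp Require Import ring lra.

Set Implicit Arguments.
Unset Strict Implicit.
Unset Printing Implicit Defensive.
Import Order.TTheory GRing.Theory Num.Theory.
Import numFieldNormedType.Exports.
Local Open Scope classical_set_scope.
Local Open Scope ring_scope.

(** Write [H = X - Y], [V = Y Y^T] and
    [W = X X^T - V = (Y H^T + H Y^T) + H H^T]. The differential of
    [f(X) = F (X X^T)] at [Y] sends [H] to [<grad F V, Y H^T + H Y^T>], so

      [D_f(X, Y) = D_F(X X^T, V) + <grad F V, H H^T>].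

    The kernel is a polynomial of degree four, and its Bregman distance is
    computed exactly ([bregman_gram_kernel]):

      [alpha/4 (2 |Y|^2 |H|^2 + (2<Y,H> + |H|^2)^2)
       + beta/4 (2 |Y^T H|^2 + |W|^2) + sigma/2 |H|^2].

    The two expressions are compared term by term, without second derivatives.
    The descent lemma ([smooth_bregman_le]) bounds [D_F(X X^T, V)] by
    [L_F/2 |W|^2], which the [|W|^2] term of the kernel absorbs. In the other
    summand, [grad F V] splits as

      [(grad F V - grad F 0 - mu_F V) + grad F 0 + mu_F V].

    Paired with [H H^T], the last part gives [mu_F |Y^T H|^2] because
    [<Y Y^T, H H^T> = |Y^T H|^2]; it is absorbed by the [beta] term since
    [mu_F <= L_F]. The middle part is at most [|grad F 0| |H|^2], hence below
    the [sigma] term. The first part is at most [(L_F - mu_F) |V| |H H^T|], and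
    [|V| |H H^T| <= |Y|^2 |H|^2], hence below the [alpha] term.

    That last bound says that [grad F - mu_F id] is [(L_F - mu_F)]-Lipschitz
    ([grad_sub_linear_lipschitz]). It is the Baillon-Haddad theorem for the
    convex function [F - mu_F/2 |.|^2], obtained here from the two quadratic
    bounds on the Bregman distance of [F].

    The kernel is strictly convex because its Bregman distance is at least
    [sigma/2 |H|^2]. *)

(** * The Frobenius inner product *)

Section FrobeniusInnerProduct.
Variables (R : realType) (m p : nat).
Implicit Types (X Y Z : 'M[R]_(m, p)) (a : R).

Lemma frob_dotE X Y : frob_dot X Y = \sum_i \sum_j X i j * Y i j.
Proof.
rewrite exchange_big; apply: eq_bigr => j _; rewrite mxE.
by apply: eq_bigr => i _; rewrite mxE.
Qed.

Lemma frob_dotC X Y : frob_dot X Y = frob_dot Y X.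
Proof.
by rewrite !frob_dotE; apply: eq_bigr => i _; apply: eq_bigr => j _; exact: mulrC.
Qed.

Lemma frob_dotDr X Y Z : frob_dot X (Y + Z) = frob_dot X Y + frob_dot X Z.
Proof. by rewrite /frob_dot mulmxDr mxtraceD. Qed.

Lemma frob_dotZr a X Y : frob_dot X (a *: Y) = a * frob_dot X Y.
Proof. by rewrite /frob_dot -scalemxAr mxtraceZ. Qed.

Lemma frob_dotNr X Y : frob_dot X (- Y) = - frob_dot X Y.
Proof. by rewrite -scaleN1r frob_dotZr mulN1r. Qed.

Lemma frob_dotDl X Y Z : frob_dot (X + Y) Z = frob_dot X Z + frob_dot Y Z.
Proof. by rewrite !(frob_dotC _ Z) frob_dotDr. Qed.

Lemma frob_dotZl a X Y : frob_dot (a *: X) Y = a * frob_dot X Y.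
Proof. by rewrite !(frob_dotC _ Y) frob_dotZr. Qed.

Lemma frob_dotNl X Y : frob_dot (- X) Y = - frob_dot X Y.
Proof. by rewrite !(frob_dotC _ Y) frob_dotNr. Qed.

Definition frob_bilinE := (frob_dotDl, frob_dotDr, frob_dotNl, frob_dotNr,
  frob_dotZl, frob_dotZr).

Lemma frob_dot_ge0 X : 0 <= frob_dot X X.
Proof.
by rewrite frob_dotE; do 2![apply: sumr_ge0 => ? _]; rewrite -expr2 sqr_ge0.
Qed.

Lemma frob_dot_eq0 X : frob_dot X X = 0 -> X = 0.
Proof.
move=> /eqP; rewrite frob_dotE psumr_eq0 => [/allP/= X0|i _]; last first.
  by apply: sumr_ge0 => j _; rewrite -expr2 sqr_ge0.
apply/matrixP => i j; rewrite mxE.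
have := X0 i (mem_index_enum _); rewrite psumr_eq0 => [/allP/= Xi0|k _].
  by have := Xi0 j (mem_index_enum _); rewrite mulf_eq0 orbb => /eqP.
by rewrite -expr2 sqr_ge0.
Qed.

Lemma frob_norm_ge0 X : 0 <= frob_norm X.
Proof. exact: sqrtr_ge0. Qed.

Lemma frob_norm_sqr X : frob_norm X ^+ 2 = frob_dot X X.
Proof. by rewrite sqr_sqrtr ?frob_dot_ge0. Qed.

(** The square [| |Y| X - |X| Y |^2 >= 0] is the inequality multiplied by
    [2 |X| |Y|], so only the case of a zero norm is left apart. *)
Lemma frob_cauchy_schwarz X Y : frob_dot X Y <= frob_norm X * frob_norm Y.
Proof.
have dot0 (Z T : 'M[R]_(m, p)) : frob_norm Z = 0 -> frob_dot Z T = 0.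
  move=> Z0; rewrite (_ : Z = 0) ?/frob_dot ?trmx0 ?mul0mx ?mxtrace0 //.
  by apply: frob_dot_eq0; rewrite -frob_norm_sqr Z0 expr0n.
have [X0|X0] := eqVneq (frob_norm X) 0; first by rewrite dot0 // X0 mul0r.
have [Y0|Y0] := eqVneq (frob_norm Y) 0.
  by rewrite frob_dotC dot0 // Y0 mulr0.
have XYgt0 : 0 < frob_norm X * frob_norm Y.
  by rewrite mulr_gt0 // lt_def ?X0 ?Y0 frob_norm_ge0.
have := frob_dot_ge0 (frob_norm Y *: X - frob_norm X *: Y).
rewrite !frob_bilinE (frob_dotC Y X) -!frob_norm_sqr => sq_ge0.
rewrite -(ler_pM2l XYgt0); lra.
Qed.

End FrobeniusInnerProduct.

(** Each entry of the product is an inner product of a row of [A] and a column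
    of [B]; Cauchy-Schwarz on the entries and summation give the claim. *)
Lemma frob_norm_mulmx (R : realType) (m n p : nat)
    (A : 'M[R]_(m, n)) (B : 'M[R]_(n, p)) :
  frob_norm (A *m B) <= frob_norm A * frob_norm B.
Proof.
rewrite -(@ler_pXn2r _ 2) ?nnegrE ?mulr_ge0 ?frob_norm_ge0 //.
rewrite exprMn !frob_norm_sqr (frob_dotE A) (frob_dotE B) exchange_big /=.
rewrite exchange_big /= frob_dotE.
rewrite [X in _ * X]exchange_big /= mulr_suml; apply: ler_sum => i _.
rewrite mulr_sumr; apply: ler_sum => j _.
have -> : (A *m B) i j = frob_dot (row i A)^T (col j B).
  rewrite frob_dotE mxE; apply: eq_bigr => k _.
  by rewrite big_ord1 !mxE.
have -> : \sum_k A i k * A i k = frob_norm (row i A)^T ^+ 2.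
  rewrite frob_norm_sqr frob_dotE; apply: eq_bigr => k _.
  by rewrite big_ord1 !mxE.
have -> : \sum_k B k j * B k j = frob_norm (col j B) ^+ 2.
  rewrite frob_norm_sqr frob_dotE; apply: eq_bigr => k _.
  by rewrite big_ord1 !mxE.
set x := (row i A)^T; set y := col j B.
rewrite -expr2 -exprMn -[leLHS]real_normK ?num_real //.
rewrite ler_pXn2r ?nnegrE ?normr_ge0 ?mulr_ge0 ?frob_norm_ge0 //.
rewrite ler_norml frob_cauchy_schwarz andbT lerNl -frob_dotNl.
apply: le_trans (frob_cauchy_schwarz _ _) _.
by rewrite /frob_norm frob_dotNl frob_dotNr opprK.
Qed.

Lemma frob_norm_tr (R : realType) (m p : nat) (X : 'M[R]_(m, p)) :
  frob_norm X^T = frob_norm X.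
Proof. by rewrite /frob_norm /frob_dot trmxK mxtrace_mulC. Qed.

(** * Bregman distances along segments *)

Lemma is_derive_line (R : realType) (V : normedModType R) (f : V -> R)
    (x v : V) (t : R) : differentiable f (x + t *: v) ->
  is_derive t (1 : R) (fun s : R => f (x + s *: v)) ('d f (x + t *: v) v).
Proof.
move=> df; have /derivableP := diff_derivable (v := v) df; rewrite deriveE //.
have E : (fun h : R => h^-1 *: (f (x + (h *: 1 + t) *: v) - f (x + t *: v))) =
    (fun h : R => h^-1 *: (f (h *: v + (x + t *: v)) - f (x + t *: v))).
  apply/funext => h; rewrite [h *: 1]mulr1 scalerDl.
  by rewrite addrCA.
move=> [dv dE]; split.
- by move: dv; rewrite /derivable -E.
- by move: dE; rewrite /derive -E.
Qed.

(** The function [phi t - (a t + c/2 t^2)] has a nonpositive derivative on the interval. *)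
Lemma derive_le_affine (R : realType) (phi dphi : R -> R) (a c : R) :
  (forall t : R, is_derive t (1 : R) phi (dphi t)) ->
  (forall t, 0 < t < 1 -> dphi t <= a + c * t) ->
  phi 1 <= phi 0 + a + c / 2.
Proof.
move=> dphiE le_dphi.
pose psi : R -> R := fun t => phi t - (a * t + c / 2 * t ^+ 2).
have dpsi (t : R) : is_derive t (1 : R) psi (dphi t - (a + c * t)).
  rewrite /psi; apply: is_derive_eq.
  rewrite /GRing.scale /=; lra.
suff : psi 1 <= psi 0 by rewrite /psi; lra.
apply: (@ler0_derive1_nincr _ psi 0 1) => //.
- move=> x; rewrite in_itv /= => x01.
  by rewrite derive1E derive_val subr_le0 le_dphi.
- apply: derivable_within_continuous => t _.
  by have [] := dpsi t.
Qed.

Lemma bregman_le (R : realType) (m p : nat) (f : 'M[R]_(m, p) -> R)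
    (c : R) (X Y : 'M[R]_(m, p)) :
  (forall Z, differentiable f Z) ->
  (forall t, 0 < t < 1 ->
     frob_dot (grad f (Y + t *: (X - Y)) - grad f Y) (X - Y) <= c * t) ->
  bregman f X Y <= c / 2.
Proof.
move=> df le_c.
have := @derive_le_affine _ (fun t => f (Y + t *: (X - Y)))
  (fun t => frob_dot (grad f (Y + t *: (X - Y))) (X - Y))
  (frob_dot (grad f Y) (X - Y)) c.
rewrite scale1r scale0r addr0 subrKC /bregman => H.
rewrite !lerBlDl addrA; apply: H => [t|t /le_c].
  by rewrite frob_dot_grad; exact: is_derive_line.
by rewrite frob_dotDl frob_dotNl lerBlDl.
Qed.

Lemma bregman_ge (R : realType) (m p : nat) (f : 'M[R]_(m, p) -> R)
    (c : R) (X Y : 'M[R]_(m, p)) :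
  (forall Z, differentiable f Z) ->
  (forall t, 0 < t < 1 ->
     c * t <= frob_dot (grad f (Y + t *: (X - Y)) - grad f Y) (X - Y)) ->
  c / 2 <= bregman f X Y.
Proof.
move=> df ge_c.
have := @derive_le_affine _ (fun t => - f (Y + t *: (X - Y)))
  (fun t => - frob_dot (grad f (Y + t *: (X - Y))) (X - Y))
  (- frob_dot (grad f Y) (X - Y)) (- c).
rewrite scale1r scale0r addr0 subrKC /bregman => H.
suff : - f X <= - f Y - frob_dot (grad f Y) (X - Y) + - c / 2 by lra.
apply: H => [t|t /ge_c].
  rewrite frob_dot_grad.
  by apply: is_deriveN; exact: is_derive_line.
by rewrite frob_dotDl frob_dotNl lerBrDl mulNr -opprD lerN2.
Qed.

(** The descent lemma: on the segment from [Y] to [X], Cauchy-Schwarz bounds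
    the increase of the directional derivative by [L t |X - Y|^2]. *)
Lemma smooth_bregman_le (R : realType) (m p : nat) (f : 'M[R]_(m, p) -> R)
    (L : R) (X Y : 'M[R]_(m, p)) :
  (forall Z, differentiable f Z) -> smooth L f ->
  bregman f X Y <= L / 2 * frob_dot (X - Y) (X - Y).
Proof.
move=> df fL; rewrite mulrAC; apply: bregman_le => // t /andP[t0 _].
apply: le_trans (frob_cauchy_schwarz _ _) _.
apply: le_trans (ler_wpM2r (frob_norm_ge0 _) (fL _ _)) _.
rewrite addrAC subrr add0r -frob_norm_sqr.
rewrite (_ : frob_norm (t *: _) = t * frob_norm (X - Y)); first by lra.
by rewrite /frob_norm frob_dotZl frob_dotZr mulrA -expr2 sqrtrM ?sqr_ge0 //
  sqrtr_sqr gtr0_norm.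
Qed.

Lemma strongly_convex_bregman_ge (R : realType) (m p : nat)
    (f : 'M[R]_(m, p) -> R) (mu : R) (X Y : 'M[R]_(m, p)) :
  (forall Z, differentiable f Z) -> strongly_convex mu f ->
  mu / 2 * frob_dot (X - Y) (X - Y) <= bregman f X Y.
Proof.
move=> df fmu; rewrite mulrAC; apply: bregman_ge => // t /andP[t0 _].
have := fmu (Y + t *: (X - Y)) Y.
rewrite addrAC subrr add0r frob_norm_sqr frob_dotZl !frob_dotZr => fmut.
rewrite -(ler_pM2l t0); lra.
Qed.

Lemma bregman_three_points (R : realType) (m p : nat) (f : 'M[R]_(m, p) -> R)
    (X Y Z : 'M[R]_(m, p)) :
  bregman f Z X =
  bregman f Y X + bregman f Z Y + frob_dot (grad f Y - grad f X) (Z - Y).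
Proof.
rewrite /bregman; move: (grad f X) (grad f Y) => gX gY.
rewrite !frob_bilinE; lra.
Qed.

(** Baillon-Haddad for [g = f - mu/2 |.|^2], which is convex with
    [D_g <= (L - mu)/2 |.|^2]. With [d = grad g X - grad g Y], convexity at the
    point reached from [Y] by a step [s] along [d] gives
    [0 <= D_g(Y + s d, X)], and expanding this by the three-point identity
    bounds [|d|^2]. *)
Lemma grad_sub_linear_lipschitz (R : realType) (m p : nat)
    (f : 'M[R]_(m, p) -> R) (mu L : R) (X Y : 'M[R]_(m, p)) :
  (forall Z, differentiable f Z) -> mu <= L ->
  strongly_convex mu f -> smooth L f ->
  frob_norm (grad f X - grad f Y - mu *: (X - Y)) <= (L - mu) * frob_norm (X - Y).
Proof.
move=> df muL fmu fL; set d := (_ - mu *: _).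
have M0 : 0 <= L - mu by lra.
rewrite -(@ler_pXn2r _ 2) ?nnegrE ?mulr_ge0 ?frob_norm_ge0 //.
rewrite exprMn !frob_norm_sqr.
have cocoercive s : s * frob_dot d d <=
    (L - mu) / 2 * (s ^+ 2 * frob_dot d d + frob_dot (X - Y) (X - Y)).
  have := strongly_convex_bregman_ge (Y + s *: d) X df fmu.
  rewrite (bregman_three_points f X Y).
  have := smooth_bregman_le Y X df fL.
  have := smooth_bregman_le (Y + s *: d) Y df fL.
  have -> : Y + s *: d - Y = s *: d by rewrite addrAC subrr add0r.
  have -> : Y + s *: d - X = s *: d - (X - Y) by rewrite opprB addrAC addrC.
  have -> : grad f Y - grad f X = - (d + mu *: (X - Y)) by rewrite subrK opprB.
  rewrite -[Y - X]opprB; move: (bregman _ _ _) (bregman _ _ _) => B1 B2.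
  move: (X - Y) d => D e; rewrite opprD !frob_bilinE (frob_dotC e D); nra.
have d0 := frob_dot_ge0 d; have D0 := frob_dot_ge0 (X - Y).
(* The optimal step is the inverse of [L - mu]; when [L = mu], any positive
   step shows that [d] vanishes. *)
have [M_eq0|M_neq0] := eqVneq (L - mu) 0.
  by have := cocoercive 1; rewrite M_eq0; lra.
have M_gt0 : 0 < L - mu by rewrite lt_def M_neq0.
have coc := cocoercive (L - mu)^-1.
rewrite -(ler_pM2l M_gt0) mulVKf // in coc; move: coc.
have -> : (L - mu) * ((L - mu) / 2 * ((L - mu)^-1 ^+ 2 * frob_dot d d +
    frob_dot (X - Y) (X - Y))) =
  (frob_dot d d + (L - mu) ^+ 2 * frob_dot (X - Y) (X - Y)) / 2 by field.
lra.
Qed.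

(** * Differentials of the Gram map and of the squared norm *)

Lemma differentiable_mx (R : realType) (V : normedModType R) (m p : nat)
    (M : V -> 'M[R]_(m, p)) (x : V) :
  (forall i j, differentiable (fun y => M y i j) x) -> differentiable M x.
Proof.
move=> dM.
have -> : M = \sum_i \sum_j (fun y => M y i j *: delta_mx i j).
  apply/funext => y; rewrite [LHS]matrix_sum_delta fct_sumE.
  by apply: eq_bigr => i _; rewrite fct_sumE.
by do 2![apply: differentiable_sum => ?]; exact: differentiableZl.
Qed.

(** Reduces the computation of a differential to expanding a polynomial in the
    line parameter. *)
Lemma diff_quadratic (R : realType) (V W : normedModType R) (g : V -> W)
    (x v : V) (l q : W) : differentiable g x ->
  (forall t : R, g (t *: v + x) = g x + t *: l + t ^+ 2 *: q) ->
  'd g x v = l.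
Proof.
move=> dg gE; rewrite -deriveE // /derive.
apply: cvg_lim => //.
have : (fun t : R => l + t *: q) t @[t --> (0 : R)^'] --> l + 0 *: q.
  apply: cvgD; first exact: cvg_cst.
  apply: cvgZr_tmp; exact: nbhs_dnbhs.
rewrite scale0r addr0; apply: cvg_trans; apply: near_eq_cvg.
near=> t.
have t0 : t != 0 by near: t; exact: nbhs_dnbhs_neq.
rewrite /= gE addrAC [g x + _]addrC addrK.
rewrite scalerDr !scalerA expr2 mulKf // mulVf // scale1r //.
Unshelve. all: by end_near.
Qed.

Section GramMap.
Variables (R : realType) (m p : nat).

Lemma differentiable_sqnorm (V : 'M[R]_(m, p)) :
  differentiable (fun Z : 'M[R]_(m, p) => frob_dot Z Z) V.
Proof.
have -> : (fun Z : 'M[R]_(m, p) => frob_dot Z Z) =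
    \sum_i \sum_j ((fun Z : 'M[R]_(m, p) => Z i j) * (fun Z => Z i j)).
  apply/funext => Z; rewrite frob_dotE fct_sumE.
  by apply: eq_bigr => i _; rewrite fct_sumE.
do 2![apply: differentiable_sum => ?].
by apply: differentiableM; exact: differentiable_coord.
Qed.

Lemma is_diff_sqnorm (V : 'M[R]_(m, p)) :
  is_diff V (fun Z : 'M[R]_(m, p) => frob_dot Z Z) (fun H => 2 * frob_dot V H).
Proof.
apply: DiffDef; first exact: differentiable_sqnorm.
apply/funext => H; apply: (diff_quadratic (q := frob_dot H H)).
  exact: differentiable_sqnorm.
move=> t; rewrite !frob_bilinE (frob_dotC H V) /GRing.scale /=; ring.
Qed.

Lemma differentiable_gram (Y : 'M[R]_(m, p)) :
  differentiable (fun X : 'M[R]_(m, p) => X *m X^T) Y.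
Proof.
apply: differentiable_mx => i j.
have -> : (fun X : 'M[R]_(m, p) => (X *m X^T) i j) =
    \sum_k ((fun X : 'M[R]_(m, p) => X i k) * (fun X => X j k)).
  apply/funext => X; rewrite mxE fct_sumE; apply: eq_bigr => k _.
  by rewrite mxE.
apply: differentiable_sum => k.
by apply: differentiableM; exact: differentiable_coord.
Qed.

Lemma is_diff_gram (Y : 'M[R]_(m, p)) :
  is_diff Y (fun X : 'M[R]_(m, p) => X *m X^T)
    (fun H => Y *m H^T + H *m Y^T).
Proof.
apply: DiffDef; first exact: differentiable_gram.
apply/funext => H; apply: (diff_quadratic (q := H *m H^T)).
  exact: differentiable_gram.
move=> t; rewrite linearD linearZ /= mulmxDl !mulmxDr.
rewrite -!scalemxAl -!scalemxAr scalerA -expr2 scalerDr.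
rewrite -addrA [RHS]addrC; congr (_ + _).
by rewrite addrA addrC [X in _ + X]addrC.
Qed.

Lemma gramB (X Y : 'M[R]_(m, p)) :
  X *m X^T = Y *m Y^T +
    ((Y *m (X - Y)^T + (X - Y) *m Y^T) + (X - Y) *m (X - Y)^T).
Proof.
rewrite -{1 2}(subrKC Y X); move: (X - Y) => H.
by rewrite linearD /= mulmxDl !mulmxDr !addrA.
Qed.

(** This identity makes [<Y Y^T, H H^T>] visibly nonnegative; for [H = Y] it
    exchanges the Gram matrices [Y Y^T] and [Y^T Y] under the norm. *)
Lemma frob_dot_gram (Y H : 'M[R]_(m, p)) :
  frob_dot (Y *m Y^T) (H *m H^T) = frob_dot (Y^T *m H) (Y^T *m H).
Proof.
rewrite /frob_dot !trmx_mul !trmxK.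
by rewrite mxtrace_mulC [in RHS]mulmxA [RHS]mxtrace_mulC !mulmxA.
Qed.

End GramMap.

(** * The kernel *)

Section GramKernel.
Variables (R : realType) (n r : nat) (alpha beta sigma : R).
Local Notation h := (@gram_kernel R n r alpha beta sigma).
Implicit Types X Y H : 'M[R]_(n, r).

Lemma gram_kernelE X :
  h X = alpha / 4 * frob_dot X X ^+ 2
        + beta / 4 * frob_dot (X *m X^T) (X *m X^T) + sigma / 2 * frob_dot X X.
Proof.
by rewrite /gram_kernel frob_dot_gram (exprM _ 2 2) !frob_norm_sqr.
Qed.

Lemma is_diff_gram_kernel Y :
  is_diff Y h (fun H => alpha * frob_dot Y Y * frob_dot Y H
    + beta / 2 * frob_dot (Y *m Y^T) (Y *m H^T + H *m Y^T)
    + sigma * frob_dot Y H).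
Proof.
have ds := is_diff_sqnorm Y.
have dP := is_diff_gram Y.
have dsP := is_diff_comp dP (is_diff_sqnorm (Y *m Y^T)).
have -> : h = (alpha / 4) *: (fun X => frob_dot X X) ^+ 2
   + (beta / 4) *: ((fun Z : 'M[R]_n => frob_dot Z Z) \o (fun X => X *m X^T))
   + (sigma / 2) *: (fun X => frob_dot X X).
  by apply/funext => X; rewrite gram_kernelE.
apply: is_diff_eq (is_diffD (is_diffD (is_diffZ (alpha / 4) (is_diffX 1 ds))
  (is_diffZ (beta / 4) dsP)) (is_diffZ (sigma / 2) ds)) _.
apply/funext => H /=.
(* Both sides are pointwise operations on functions; spell out their values. *)
rewrite -[LHS]/(alpha / 4 * (2 * frob_dot Y Y ^+ 1 * (2 * frob_dot Y H))
  + beta / 4 * (2 * frob_dot (Y *m Y^T) (Y *m H^T + H *m Y^T))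
  + sigma / 2 * (2 * frob_dot Y H)).
rewrite -[RHS]/(alpha * frob_dot Y Y * frob_dot Y H
  + beta / 2 * frob_dot (Y *m Y^T) (Y *m H^T + H *m Y^T)
  + sigma * frob_dot Y H).
lra.
Qed.

(** Each summand of the kernel is, up to a factor, [|P X|^2] for a map [P] of
    degree at most two: [X |-> |X|^2], [X |-> X X^T] and the identity. The
    Bregman distance of [|P X|^2] is the squared norm of the increment of [P]
    plus twice the inner product of [P Y] with the part of that increment that
    is quadratic in [H]; [frob_dot_gram] rewrites this inner product for the
    second map. *)
Lemma bregman_gram_kernel X Y (H := X - Y)
    (U := Y *m H^T + H *m Y^T) (W := U + H *m H^T) :
  bregman h X Y =
    alpha / 4 * (2 * frob_dot Y Y * frob_dot H H
                 + (2 * frob_dot Y H + frob_dot H H) ^+ 2)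
    + beta / 4 * (2 * frob_dot (Y^T *m H) (Y^T *m H) + frob_dot W W)
    + sigma / 2 * frob_dot H H.
Proof.
rewrite /bregman frob_dot_grad; have [_ ->] := is_diff_gram_kernel Y.
rewrite !gram_kernelE (gramB X Y) -frob_dot_gram -/H -/U -/W.
rewrite -[in frob_dot X _](subrKC Y X) -/H.
rewrite {}/W; move: H (Y *m Y^T) (H *m H^T) U => D V K T.
rewrite !frob_bilinE (frob_dotC D Y) (frob_dotC T V) (frob_dotC K V) (frob_dotC K T).
lra.
Qed.

Lemma bregman_gram_kernel_ge X Y : 0 <= alpha -> 0 <= beta ->
  sigma / 2 * frob_dot (X - Y) (X - Y) <= bregman h X Y.
Proof.
move=> alpha0 beta0; rewrite bregman_gram_kernel lerDr.
by apply: addr_ge0; rewrite mulr_ge0 ?divr_ge0 // addr_ge0 ?sqr_ge0 ?mulr_ge0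
  ?frob_dot_ge0.
Qed.

End GramKernel.

(** Compare [f] with its tangent plane at the intermediate point [Z]: the
    first order terms at [X] and [Y] cancel in the convex combination. *)
Lemma bregman_gt0_strictly_convex (R : realType) (m p : nat)
    (f : 'M[R]_(m, p) -> R) :
  (forall X Y, X <> Y -> 0 < bregman f X Y) -> strictly_convex f.
Proof.
move=> f_gt0 X Y t XY /andP[t0 t1]; set Z := _ + _ *: Y.
have t1' : 0 < 1 - t by rewrite subr_gt0.
have XZ : X - Z = (1 - t) *: (X - Y).
  by rewrite /Z opprD addrA -{1}[X]scale1r -scalerBl -scalerBr.
have YZ : Y - Z = - t *: (X - Y).
  rewrite /Z scalerBl scale1r opprD opprB addrCA [Y + _]addrC subrK.
  by rewrite scalerBr !scaleNr opprK addrC.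
have XY0 : X - Y != 0 by rewrite subr_eq0; apply/eqP.
have BX : 0 < bregman f X Z.
  by apply: f_gt0 => /eqP; rewrite -subr_eq0 XZ scaler_eq0 (negPf XY0) orbF gt_eqF.
have BY : 0 < bregman f Y Z.
  apply: f_gt0 => /eqP; rewrite -subr_eq0 YZ scaler_eq0 (negPf XY0) orbF.
  by rewrite oppr_eq0 gt_eqF.
move: BX BY; rewrite /bregman XZ YZ !frob_dotZr.
rewrite -(pmulr_rgt0 _ t0) => BX; rewrite -(pmulr_rgt0 _ t1') => BY.
move: (frob_dot _ _) BX BY => g; lra.
Qed.

(** * Relative smoothness *)

Lemma frob_norm_gram_le (R : realType) (m p : nat) (H : 'M[R]_(m, p)) :
  frob_norm (H *m H^T) <= frob_dot H H.
Proof.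
by rewrite -frob_norm_sqr expr2 -{2}(frob_norm_tr H) frob_norm_mulmx.
Qed.

(** The contribution of [<grad F V, H H^T>], with [grad F V] split into its
    value at 0, the linear part [mu V] and a remainder controlled by
    [grad_sub_linear_lipschitz]. The three terms on the right correspond to the
    three parameters of the kernel. *)
Lemma grad_gram_le (R : realType) (n r : nat) (F : 'M[R]_(n, n) -> R)
    (mu L : R) (Y H : 'M[R]_(n, r)) :
  (forall Z, differentiable F Z) -> mu <= L ->
  strongly_convex mu F -> smooth L F ->
  frob_dot (grad F (Y *m Y^T)) (H *m H^T) <=
    (L - mu) * (frob_dot Y Y * frob_dot H H)
    + frob_norm (grad F 0) * frob_dot H H
    + mu * frob_dot (Y^T *m H) (Y^T *m H).
Proof.
move=> dF muL Fmu FL.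
have := grad_sub_linear_lipschitz (Y *m Y^T) 0 dF muL Fmu FL.
rewrite subr0 -frob_dot_gram.
have := frob_norm_gram_le H; have := frob_norm_gram_le Y.
move: (Y *m Y^T) (H *m H^T) => V K V_le K_le; set d := (X in frob_norm X) => d_le.
have -> : grad F V = d + grad F 0 + mu *: V by rewrite /d addrAC !subrK.
rewrite 2!frob_dotDl frob_dotZl lerD2r lerD //.
  apply: le_trans (frob_cauchy_schwarz _ _) _; rewrite mulrA.
  apply: ler_pM => //; rewrite ?frob_norm_ge0 //.
  by apply: le_trans d_le _; rewrite ler_wpM2l // subr_ge0.
apply: le_trans (frob_cauchy_schwarz _ _) _.
by rewrite ler_wpM2l // frob_norm_ge0.
Qed.

Theorem proposition2p3 (R : realType) (n r : nat)
    (hn : (1 <= n)%N) (hr : (1 <= r)%N) (hrn : (r <= n)%N)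
    (F : 'M[R]_(n, n) -> R) (muF LF : R)
    (hmu : 0 <= muF) (hmuL : muF <= LF)
    (hC2 : twice_continuously_differentiable F)
    (hsc : strongly_convex muF F) (hsm : smooth LF F)
    (alpha beta sigma : R)
    (halpha0 : 0 <= alpha) (hbeta0 : 0 <= beta) (hsigma0 : 0 < sigma)
    (halpha : 2 * (LF - muF) <= alpha)
    (hbeta : 2 * LF <= beta)
    (hsigma : 2 * frob_norm (grad F 0) <= sigma) :
  relatively_smooth 1 (gram_kernel alpha beta sigma)
    (fun X : 'M[R]_(n, r) => F (X *m X^T)).
Proof.
have [dF _] := hC2.
have df (Y : 'M[R]_(n, r)) : is_diff Y (fun X : 'M[R]_(n, r) => F (X *m X^T))
    ('d F (Y *m Y^T) \o (fun H : 'M[R]_(n, r) => Y *m H^T + H *m Y^T)).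
  have dG := is_diff_gram Y.
  exact: is_diff_comp dG (differentiableP (dF _)).
(* The instance [df] also settles the differentiability of [f]. *)
split => //.
- split=> [X|]; first by have [] := is_diff_gram_kernel alpha beta sigma X.
  apply: bregman_gt0_strictly_convex => X Y XY.
  apply: lt_le_trans (bregman_gram_kernel_ge _ _ _ halpha0 hbeta0).
  rewrite mulr_gt0 ?divr_gt0 // lt_def frob_dot_ge0 andbT.
  by apply/eqP => /frob_dot_eq0 /subr0_eq.
move=> X Y; rewrite frob_dot_grad; have [_ ->] := df Y; rewrite mul1r /=.
have := grad_gram_le Y (X - Y) dF hmuL hsc hsm.
have := smooth_bregman_le (X *m X^T) (Y *m Y^T) dF hsm.
rewrite bregman_gram_kernel /bregman -frob_dot_grad (gramB X Y).
set H := X - Y; set V := Y *m Y^T; set K := H *m H^T.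
set U := Y *m H^T + H *m Y^T.
rewrite (addrC V) addrK [frob_dot (grad F V) (U + K)]frob_dotDr.
have alpha_le : (LF - muF) * (frob_dot Y Y * frob_dot H H) <=
    alpha / 2 * (frob_dot Y Y * frob_dot H H).
  by rewrite ler_wpM2r ?mulr_ge0 ?frob_dot_ge0 //; lra.
have alpha_sq : 0 <= alpha / 4 * (2 * frob_dot Y H + frob_dot H H) ^+ 2.
  by rewrite mulr_ge0 ?sqr_ge0 ?divr_ge0.
have sigma_le : frob_norm (grad F 0) * frob_dot H H <= sigma / 2 * frob_dot H H.
  by rewrite ler_wpM2r ?frob_dot_ge0 //; lra.
have beta_le : muF * frob_dot (Y^T *m H) (Y^T *m H) <=
    beta / 2 * frob_dot (Y^T *m H) (Y^T *m H).
  by rewrite ler_wpM2r ?frob_dot_ge0 //; lra.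
have beta_le' : LF / 2 * frob_dot (U + K) (U + K) <=
    beta / 4 * frob_dot (U + K) (U + K).
  by rewrite ler_wpM2r ?frob_dot_ge0 //; lra.
move: (F _) (F V) (frob_dot (grad F V) U) (frob_dot (grad F V) K) => a b c e.
move: alpha_le alpha_sq sigma_le beta_le beta_le'.
move: (frob_dot (U + K) _) (frob_dot (_ *m _) _) (frob_norm _) => w q N.
move: (frob_dot Y Y) (frob_dot Y H) (frob_dot H H) => y m h.
lra.
Qed.
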